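(* Let $J\ge 2$ be an integer and $x_J=\frac{\pi}{J+1}$. The optimal coefficient $c_2^J$ is given by $$c_2^J = 1-\tan^2\left(\frac{x_J}{2}\right),$$ and the corresponding principal error constant $|C_3^J|$ is $$|C_3^J| = \frac{1}{12}+\frac14\tan^2\left(\frac{x_J}{2}\right).$$
   Context: For an integer $J\ge 2$ and real coefficients $\{c_\ell^J\}_{\ell=2}^J\subset\mathbb{R}$, the truncated trapezoidal rule of order $J$ (TTR$_J$) is the linear multistep method with generating function $\delta_{\mathrm{TTR}_J}:\mathbb{C}\to\mathbb{C}$, $$\delta_{\mathrm{TTR}_J}(\zeta) = (1-\zeta)+\tfrac12(1-\zeta)^2+\sum_{\ell=2}^J 2^{-\ell}c_\ell^J(1-\zeta)^{\ell+1}.$$ The method is called A-stable if $\operatorname{Re}\bigl(\delta_{\mathrm{TTR}_J}(e^{\mathrm{i}\theta})\bigr)\ge 0$ for all $\theta\in[0,2\pi]$. The coefficients $\{c_\ell^J\}_{\ell=2}^J$ are called optimal if this A-stability condition is satisfied and $c_2^J$ is maximal among all real coefficient tuples $(c_2^J,\dots,c_J^J)$ for which the A-stability condition is satisfied. Write $\delta_{\mathrm{TTR}_J}(e^{\mathrm{i}\theta})=\sum_{k=1}^\infty \mathrm{i}^k C_k^J\theta^k$ with $C_k^J\in\mathbb{R}$. Then $C_1^J=-1$, $C_2^J=0$, and $C_3^J=\frac13-\frac{c_2^J}{4}$; the coefficient $C_3^J$ (or $|C_3^J|$) is called the principal error constant of the method. *)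

(* Defs.v *)
From HB Require Import structures.
From mathcomp Require Import all_boot all_order all_algebra.
From mathcomp Require Import all_classical all_reals all_analysis.
From mathcomp Require Import complex.
Set Implicit Arguments.
Unset Strict Implicit.
Unset Printing Implicit Defensive.
Import Order.TTheory GRing.Theory Num.Theory numFieldNormedType.Exports.
Local Open Scope classical_set_scope.
Local Open Scope ring_scope.
Local Open Scope complex_scope.

(* A coefficient tuple (c_2, ..., c_J) is given by a function [c : nat -> R],
   of which only the values at 2, ..., J matter. *)
Definition delta_TTR (R : realType) (J : nat) (c : nat -> R) (z : R[i]) : R[i] :=
  (1 - z) + 2^-1 * (1 - z) ^+ 2
  + \sum_(2 <= l < J.+1) 2 ^- l * (c l)%:C * (1 - z) ^+ l.+1.

Definition expi (R : realType) (theta : R) : R[i] := cos theta +i* sin theta.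

Definition A_stable (R : realType) (J : nat) (c : nat -> R) : Prop :=
  forall theta : R, 0 <= theta <= 2 * pi ->
    0 <= complex.Re (delta_TTR J c (expi theta)).

Definition optimal (R : realType) (J : nat) (c : nat -> R) : Prop :=
  A_stable J c /\ forall c' : nat -> R, A_stable J c' -> c' 2%N <= c 2%N.

(* [C k] is the real coefficient C_k of (i theta)^k for k >= 1; [C 0] plays no
   role. Convergence is for the topology of R[i] given by the complex modulus. *)
Definition theta_expansion (R : realType) (J : nat) (c C : nat -> R) : Prop :=
  forall theta : R,
    (fun n => \sum_(1 <= k < n) 'i%C ^+ k * (C k)%:C * theta%:C ^+ k : R[i]^o) @ \oo
      --> (delta_TTR J c (expi theta) : R[i]^o).

(* Main.v *)
Require Import Defs.
From mathcomp Require Import all_boot all_order all_algebra.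
From mathcomp Require Import all_classical all_reals all_analysis.
From mathcomp Require Import complex zify ring lra.

(** Write zeta = - w with w = e^(it), and v = (1 + w) / 2, so that
    1 - zeta = 2 v.  Since v = cos (t/2) e^(it/2), one has
    v^4 = cos (t/2)^4 w^2; hence Re v^(l+1) = cos (t/2)^4 Re (w^2 v^(l-3)) for
    l >= 3, and a short computation with the remaining terms gives
    [Re_delta]
<<
      Re delta (- w) = cos (t/2)^4 Re Q(w),
      Q(w) = (4 - 2 c_2) + 4 c_2 w + 2 w^2 sum_(3 <= l <= J) c_l v^(l-3).
>>
    A-stability thus means that the cosine polynomial Re Q(e^(it)) is
    nonnegative.  Expanding in powers of v instead of w shows that the
    coefficients of w^2, ..., w^(J-1) in Q are arbitrary ([quot_poly_onto]),
    whereas the first two are tied to c_2.  So maximizing c_2 is the problem of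
    Fejer: how large can a_1 / a_0 be for a nonnegative cosine polynomial
    a_0 + a_1 cos t + ... of degree less than J?  The answer is 2 cos x with
    x = pi / (J + 1), which gives c_2 (1 + cos x) <= 2 cos x, and
    2 cos x / (1 + cos x) = 1 - tan^2 (x/2).

    The upper bound in Fejer's problem ([fejer_bound]) comes from an exact
    quadrature: at the J + 1 nodes (2 j + 1) x the weights cos x - cos t are
    nonnegative, and equidistribution of the nodes reduces the weighted sum of
    the values of the polynomial to (J + 1) (a_0 cos x - a_1 / 2).  The bound is
    attained ([fejer_sharp]) by the squared modulus of
    sum_(k < J) sin ((k + 1) x) w^k, because sin (k x) + sin ((k + 2) x) =
    2 cos x sin ((k + 1) x) and the sines vanish at both ends.

    For the error constant, delta (e^(i theta)) = sum_m d_m e^(i m theta) with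
    real d_m, so expanding the exponentials gives C_k = sum_m d_m m^k / k!.
    The third moment of (d_m) is a combination of derivatives of delta at 1,
    and equals 2 - 3 c_2 / 2.  Any other admissible sequence C has the same
    C_3, as a power series that converges to zero at all nonzero real points
    has zero coefficients ([pseries_eq0]). *)

Set Implicit Arguments.
Unset Strict Implicit.
Unset Printing Implicit Defensive.
Import Order.TTheory GRing.Theory Num.Theory numFieldNormedType.Exports.
Local Open Scope classical_set_scope.
Local Open Scope ring_scope.
Local Open Scope complex_scope.

(** * Cosine polynomials *)

Section CosinePolynomials.
Variable R : realType.
Implicit Types (p q : {poly R}) (s t x : R).

Lemma expiD s t : expi (s + t) = expi s * expi t.
Proof.
by rewrite /expi sinD cosD; apply/eqP; rewrite eq_complex /= eqxx addrC /= eqxx.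
Qed.

Lemma expi0 : expi (0 : R) = 1.
Proof. by rewrite /expi sin0 cos0. Qed.

Lemma expiX t n : expi t ^+ n = expi (n%:R * t).
Proof.
elim: n => [|n IHn]; first by rewrite mul0r expi0.
by rewrite exprS IHn -expiD -[in RHS]natr1 mulrDl mul1r addrC.
Qed.

Lemma expiN t : - expi t = expi (t + pi).
Proof. by rewrite /expi cosDpi sinDpi. Qed.

Definition cos_poly p t : R := complex.Re (map_poly (real_complex R) p).[expi t].

Lemma ReD (z1 z2 : R[i]) : complex.Re (z1 + z2) = complex.Re z1 + complex.Re z2.
Proof. by case: z1 z2 => [? ?] []. Qed.

Lemma ReZ a (z : R[i]) : complex.Re (a%:C * z) = a * complex.Re z.
Proof. by case: z => u v /=; rewrite mul0r subr0. Qed.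

Lemma cos_polyD p q t : cos_poly (p + q) t = cos_poly p t + cos_poly q t.
Proof. by rewrite /cos_poly rmorphD /= hornerD ReD. Qed.

Lemma cos_polyZ a p t : cos_poly (a *: p) t = a * cos_poly p t.
Proof. by rewrite /cos_poly map_polyZ /= hornerZ ReZ. Qed.

Lemma cos_poly0 t : cos_poly 0 t = 0.
Proof. by rewrite /cos_poly rmorph0 horner0. Qed.

Lemma cos_polyXn n t : cos_poly 'X^n t = cos (n%:R * t).
Proof. by rewrite /cos_poly map_polyXn hornerXn expiX. Qed.

Lemma cos_poly_sum (I : Type) (r : seq I) (P : pred I) (F : I -> {poly R}) t :
  cos_poly (\sum_(i <- r | P i) F i) t = \sum_(i <- r | P i) cos_poly (F i) t.
Proof.
apply: (big_morph (fun p => cos_poly p t)) => [p q|]; [exact: cos_polyD | exact: cos_poly0].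
Qed.

Lemma cos_polyE n p t : (size p <= n)%N ->
  cos_poly p t = \sum_(k < n) p`_k * cos (k%:R * t).
Proof.
move=> sp; rewrite -{1}(coefK p) poly_def cos_poly_sum.
rewrite (big_ord_widen n (fun k => cos_poly (p`_k *: 'X^k) t)) // big_mkcond /=.
apply: eq_bigr => k _; rewrite cos_polyZ cos_polyXn; case: ltnP => // sk.
by rewrite nth_default // mul0r.
Qed.

Lemma continuous_cos_poly p : continuous (cos_poly p).
Proof.
have -> : cos_poly p = (fun t => \sum_(k < size p) p`_k * cos (k%:R * t)).
  by apply/funext => t; apply: cos_polyE.
elim: (size p) => [|n IHn] t.
  rewrite (_ : (fun _ => _) = cst 0); first exact: cvg_cst.
  by apply/funext => u; rewrite big_ord0.
rewrite (_ : (fun _ => _) = (fun u => \sum_(k < n) p`_k * cos (k%:R * u)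
   + p`_n * cos (n%:R * u))); last by apply/funext => u; rewrite big_ord_recr.
apply: cvgD; first exact: IHn.
apply: cvgM; first exact: cvg_cst.
apply: (@continuous_comp _ _ _ (fun u : R => n%:R * u) cos); last exact: continuous_cos.
by apply: cvgM; [exact: cvg_cst | exact: cvg_id].
Qed.

(** Multiplying by 2 sin (k pi / N) makes the sum telescope to
    sin (2 k pi) - sin 0. *)
Lemma sum_cos_nodes N k : (0 < k < N)%N ->
  \sum_(j < N) cos (k%:R * ((2 * j + 1)%N%:R * (pi / N%:R))) = 0 :> R.
Proof.
move=> /andP[k0 kN]; have N0 : N%:R != 0 :> R by rewrite pnatr_eq0; lia.
set y : R := k%:R * (pi / N%:R).
have sy : sin y != 0.
  have Npos : 0 < N%:R :> R by rewrite ltr0n; lia.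
  rewrite gt_eqF // sin_gt0_pi //; apply/andP; split.
    by rewrite /y mulr_gt0 ?ltr0n // divr_gt0 ?pi_gt0.
  by rewrite /y mulrA ltr_pdivrMr // mulrC ltr_pM2l ?pi_gt0 // ltr_nat.
apply: (mulfI (_ : 2 * sin y != 0)); first by rewrite mulf_neq0 // pnatr_eq0.
rewrite mulr0 mulr_sumr.
transitivity (\sum_(0 <= j < N)
    (sin ((2 * j.+1)%N%:R * y) - sin ((2 * j)%N%:R * y))).
  rewrite big_mkord; apply: eq_bigr => j _.
  rewrite mulrCA -/y; set z := (2 * j + 1)%N%:R * y.
  have -> : (2 * j.+1)%N%:R * y = z + y by rewrite /z; ring.
  have -> : (2 * j)%N%:R * y = z - y by rewrite /z; ring.
  by rewrite sinD sinB; ring.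
rewrite telescope_sumr // muln0 mul0r sin0 subr0.
have -> : (2 * N)%N%:R * y = 0 + pi *+ 2 *+ k.
  by rewrite /y add0r -mulrnA -mulr_natr !natrM; field.
by rewrite (periodicn (@sinD2pi R)) sin0.
Qed.

(** The arc [x, 2 pi - x] is symmetric about pi, and cosine decreases on its
    first half. *)
Lemma le_cos_arc x t : 0 <= x -> x <= t <= 2 * pi - x -> cos t <= cos x.
Proof.
move=> x0 /andP[xt tx].
have le_cos u v : 0 <= u -> u <= v -> v <= pi -> cos v <= cos u :> R.
  move=> u0; rewrite le_eqVlt => /predU1P[->//|uv] vpi; apply: ltW.
  by rewrite ltr_cos // in_itv /=; apply/andP; split; lra.
have [tpi|pit] := lerP t pi; first exact: le_cos.
have -> : cos t = cos (2 * pi - t).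
  by rewrite addrC mulr_natl cosD2pi cosN.
by apply: le_cos => //; lra.
Qed.

(** Fejer's inequality.  The number of nodes, J + 1, is the smallest for which
    the quadrature is exact on (cos x - cos t) cos_poly p t, of degree at most
    J; with nodes at odd multiples of x, the closest ones to 0 are exactly at
    distance x, where the weight vanishes. *)
Lemma fejer_bound J p : (size p <= J)%N ->
  (forall t, 0 <= t <= 2 * pi -> 0 <= cos_poly p t) ->
  p`_1 <= 2 * cos (pi / J.+1%:R) * p`_0.
Proof.
move=> sp p_ge0; set x : R := pi / J.+1%:R.
have N0 : 0 < J.+1%:R :> R by rewrite ltr0n.
have Nx : J.+1%:R * x = pi by rewrite /x mulrCA mulfV ?mulr1 ?gt_eqF.
have x0 : 0 < x by rewrite divr_gt0 ?pi_gt0.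
pose node (j : nat) : R := (2 * j + 1)%N%:R * x.
have mom k : (k <= J)%N ->
    \sum_(j < J.+1) cos (k%:R * node j) = (k == 0%N)%:R * J.+1%:R.
  case: k => [_|k kJ]; last by rewrite mul0r sum_cos_nodes.
  rewrite (eq_bigr (fun=> 1)) => [|j _]; last by rewrite mul0r cos0.
  by rewrite sumr_const card_ord mul1r.
have : 0 <= \sum_(j < J.+1) (cos x - cos (node j)) * cos_poly p (node j).
  apply: sumr_ge0 => j _; apply: mulr_ge0 => [|//].
    rewrite subr_ge0; apply: le_cos_arc; first exact: ltW.
    rewrite /node; apply/andP; split.
      by rewrite ler_peMl ?(ltW x0) // ler1n; lia.
    rewrite -Nx -[X in _ <= _ - X]mul1r mulrA -mulrBl ler_pM2r //.
    by rewrite -natrM lerBrDr natr1 ler_nat; have := ltn_ord j; lia.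
  apply: p_ge0; rewrite /node mulr_ge0 ?(ltW x0) //= -Nx mulrA ler_pM2r //.
  by rewrite -natrM ler_nat; have := ltn_ord j; lia.
(* Only the coefficients of index 0 and 1 survive the quadrature, by [mom]. *)
have -> : \sum_(j < J.+1) (cos x - cos (node j)) * cos_poly p (node j) =
   \sum_(k < J) p`_k * (cos x * (k == 0 :> nat)%:R - (k == 1 :> nat)%:R / 2) * J.+1%:R.
  transitivity (\sum_(k < J) \sum_(j < J.+1)
     p`_k * ((cos x - cos (node j)) * cos (k%:R * node j))).
    rewrite exchange_big; apply: eq_bigr => j _.
    by rewrite (cos_polyE _ sp) mulr_sumr; apply: eq_bigr => k _; rewrite mulrCA.
  apply: eq_bigr => k _; rewrite -mulr_sumr -mulrA; congr (_ * _).
  transitivity (cos x * \sum_(j < J.+1) cos (k%:R * node j)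
     - \sum_(j < J.+1) (cos (k.+1%:R * node j) + cos (k%:R * node j - node j)) / 2).
    rewrite mulr_sumr -sumrB; apply: eq_bigr => j _.
    have -> : k.+1%:R * node j = k%:R * node j + node j.
      by rewrite -natr1 mulrDl mul1r.
    by rewrite cosD cosB; field.
  rewrite mom ?(ltnW (ltn_ord k)) // -mulr_suml big_split /= mom //= mul0r add0r.
  case: (nat_of_ord k) (ltn_ord k) => [|k'] kJ /=.
    rewrite (eq_bigr (fun j : 'I_J.+1 => cos (1%:R * node j))); last first.
      by move=> j _; rewrite mul0r add0r cosN mul1r.
    by rewrite mom //= mul0r; field.
  rewrite (eq_bigr (fun j : 'I_J.+1 => cos (k'%:R * node j))); last first.
    by move=> j _; congr cos; ring.
  by rewrite mom /=; [rewrite eqSS; field | lia].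
rewrite -mulr_suml pmulr_lge0 //.
rewrite /x; case: J sp {mom N0 Nx x0 node p_ge0 x} => [|[|J]] sp.
- by move: sp; rewrite leqn0 size_poly_eq0 => /eqP ->; rewrite !coef0 mulr0.
(* For J = 1 there is no coefficient of index 1, and x = pi / 2. *)
- rewrite big_ord1 /= [p`_1]nth_default // => _.
  by rewrite cos_pihalf mulr0 mul0r.
rewrite big_ord_recl big_ord_recl big1 => [|i _] /=; last by rewrite !mulr0 mul0r subr0 mulr0.
by move=> h; lra.
Qed.

End CosinePolynomials.

(** * Sharpness of Fejer's inequality *)

Section Fejer.
Variable R : realType.
Implicit Types (t : R) (s : nat -> R).

(** The cosine polynomial that represents the squared modulus of
    sum_(k < J) s_k e^(ikt): the exponent is the distance between k and l. *)
Definition autocorr J s : {poly R} :=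
  \sum_(k < J) \sum_(l < J) (s k * s l) *: 'X^((k - l) + (l - k)).

Lemma size_autocorr J s : (size (autocorr J s) <= J)%N.
Proof.
apply: (leq_trans (size_sum _ _ _)); apply/bigmax_leqP => k _.
apply: (leq_trans (size_sum _ _ _)); apply/bigmax_leqP => l _.
apply: (leq_trans (size_scale_leq _ _)).
by rewrite size_polyXn; have := ltn_ord k; have := ltn_ord l; lia.
Qed.

Lemma cos_poly_autocorr J s t : cos_poly (autocorr J s) t =
  (\sum_(k < J) s k * cos (k%:R * t)) ^+ 2 + (\sum_(k < J) s k * sin (k%:R * t)) ^+ 2.
Proof.
rewrite !expr2 !big_distrlr /= -big_split /= cos_poly_sum; apply: eq_bigr => k _.
rewrite -big_split /= cos_poly_sum; apply: eq_bigr => l _.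
rewrite cos_polyZ cos_polyXn -mulrACA -[s l * _]mulrC mulrACA.
have -> : cos ((k - l + (l - k))%N%:R * t) = cos (k%:R * t - l%:R * t).
  have [lk|/ltnW kl] := leqP l k.
    by rewrite (_ : (l - k = 0)%N) ?addn0 ?natrB ?mulrBl //; lia.
  rewrite (_ : (k - l = 0)%N) ?add0n ?natrB ?mulrBl //; last lia.
  by rewrite -cosN opprB.
by rewrite cosB; ring.
Qed.

Lemma coef0_autocorr J s : (autocorr J s)`_0 = \sum_(k < J) s k ^+ 2.
Proof.
rewrite coef_sum; apply: eq_bigr => k _.
rewrite coef_sum (bigD1 k) //= coefZ coefXn big1 => [|l lk].
  by rewrite subnn mulr1 addr0 expr2.
rewrite coefZ coefXn (_ : (_ == _) = false) ?mulr0 //.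
by apply/negP => /eqP h; case/eqP: lk; apply: val_inj => /=; lia.
Qed.

Lemma coef1_autocorr J s : (autocorr J s)`_1 =
  \sum_(k < J) s k * ((if (0 < k)%N then s k.-1 else 0)
                      + (if (k.+1 < J)%N then s k.+1 else 0)).
Proof.
rewrite coef_sum; apply: eq_bigr => k _.
rewrite coef_sum.
transitivity (\sum_(l < J) s k * ((if l == k.+1 :> nat then s l else 0)
                      + if l.+1 == k :> nat then s l else 0)).
  apply: eq_bigr => l _; rewrite coefZ coefXn -mulrA; congr (_ * _).
  have [e1|n1] := eqVneq (l : nat) k.+1; have [e2|n2] := eqVneq l.+1 (k : nat).
  - lia.
  - by rewrite (_ : (1 == _)%N) ?mulr1 ?addr0 //; apply/eqP; lia.
  - by rewrite (_ : (1 == _)%N) ?mulr1 ?add0r //; apply/eqP; lia.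
  - rewrite (_ : (1 == _)%N = false) ?mulr0 ?addr0 //.
    by apply/negbTE/eqP; move: n1 n2; lia.
rewrite -mulr_sumr big_split /= addrC -!big_mkcond /=; congr (_ * (_ + _)).
  case: k => [[|k] kJ] /=; first by rewrite big1.
  rewrite (eq_bigl (fun l : 'I_J => l == k :> nat)) ?big_ord1_eq //.
  by rewrite ltnW.
by rewrite big_ord1_eq.
Qed.

(** The sequence sin ((k + 1) x) is the positive eigenvector, for the
    eigenvalue 2 cos x, of the adjacency matrix of the path on J vertices; this
    is what maximizes the ratio of the first two autocorrelations. *)
Lemma fejer_sharp J : (0 < J)%N -> exists p : {poly R},
  [/\ (size p <= J)%N, forall t, 0 <= cos_poly p t, 0 < p`_0
    & p`_1 = 2 * cos (pi / J.+1%:R) * p`_0].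
Proof.
move=> J0; set x : R := pi / J.+1%:R; pose s k : R := sin (k.+1%:R * x).
have x0 : 0 < x by rewrite divr_gt0 ?pi_gt0.
exists (autocorr J s); split.
- exact: size_autocorr.
- by move=> t; rewrite cos_poly_autocorr addr_ge0 ?sqr_ge0.
- rewrite coef0_autocorr (bigD1 (Ordinal J0)) //= ltr_wpDr //.
    by apply: sumr_ge0 => k _; rewrite sqr_ge0.
  rewrite exprn_gt0 // /s mul1r sin_gt0_pi // x0 /= /x.
  by rewrite ltr_pdivrMr // ltr_pMr ?pi_gt0 // ltr1n.
rewrite coef0_autocorr coef1_autocorr mulr_sumr; apply: eq_bigr => k _.
(* At both ends the missing neighbour counts for zero, and so does the sine
   there: sin 0 = 0 and sin ((J + 1) x) = sin pi = 0. *)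
have -> : (if (0 < k)%N then s k.-1 else 0) = sin (k.+1%:R * x - x).
  case: (k : nat) => [|k'] /=; first by rewrite mul1r subrr sin0.
  by congr sin; ring.
have -> : (if (k.+1 < J)%N then s k.+1 else 0) = sin (k.+1%:R * x + x).
  rewrite [RHS](_ : _ = s k.+1); last by congr sin; ring.
  case: ltnP => // Jk; rewrite (_ : k.+1 = J); last by have := ltn_ord k; lia.
  by rewrite /s /x mulrCA mulfV ?mulr1 ?sinpi ?pnatr_eq0.
by rewrite sinB sinD /s; ring.
Qed.

End Fejer.

(** * A-stability as nonnegativity of a cosine polynomial *)

Section Reduction.
Variable R : realType.
Implicit Types (p : {poly R}) (t : R) (c : nat -> R).

(** The quotient of Re delta (- e^(it)) by cos (t/2)^4 is the real part of this
    polynomial at e^(it). *)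
Definition quot_poly J c : {poly R} :=
  (4 - 2 * c 2%N)%:P + (4 * c 2%N) *: 'X +
  'X^2 * \sum_(3 <= l < J.+1) (2 * c l) *: (2^-1 *: ('X + 1)) ^+ (l - 3).

Lemma size_quot_poly J c : (2 <= J)%N -> (size (quot_poly J c) <= J)%N.
Proof.
move=> J2; rewrite /quot_poly.
apply: (leq_trans (size_polyD _ _)); rewrite geq_max; apply/andP; split.
  apply: (leq_trans (size_polyD _ _)); rewrite geq_max.
  rewrite (leq_trans (size_polyC_leq1 _)) /=; last lia.
  by rewrite (leq_trans (size_scale_leq _ _)) // size_polyX.
case: (ltnP 2 J) => J3; last by rewrite big_geq // mulr0 size_poly0.
apply: (leq_trans (size_polyMleq _ _)); rewrite size_polyXn /=.
set r := (X in size X).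
suff : (size r <= J - 2)%N by move: (size r); lia.
rewrite /r {r} big_seq.
apply: (leq_trans (size_sum _ _ _)); apply/bigmax_leqP_seq => l; rewrite mem_index_iota => lJ _.
apply: (leq_trans (size_scale_leq _ _)).
apply: (leq_trans (size_poly_exp_leq _ _)).
apply: (@leq_ltn_trans (1 * (l - 3))); last lia.
rewrite leq_mul2r; apply/orP; right.
rewrite -subn1 leq_subLR (leq_trans (size_scale_leq _ _)) //.
by rewrite -[1]polyC1 size_XaddC.
Qed.

(** The two leading terms of delta are those of - log zeta in powers of
    1 - zeta.  Hence delta (e^(i theta)) is - i theta plus real multiples of
    (1 - zeta)^3 and higher powers, and its real part vanishes to order 4 at
    zeta = 1, that is at t = pi; this is the factor cos (t/2)^4. *)
Lemma Re_delta J c t : (2 <= J)%N ->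
  complex.Re (delta_TTR J c (- expi t)) =
  cos (t / 2) ^+ 4 * cos_poly (quot_poly J c) t.
Proof.
move=> J2; set u := t / 2; have tu : t = u + u by rewrite /u; field.
set w := expi t; pose v : R[i] := (1 + w) / 2.
pose T := \sum_(3 <= l < J.+1) (2 * c l)%:C * v ^+ (l - 3).
have vE : v = (cos u)%:C * expi u.
  have -> : v = (2^-1)%:C * (1 + w) by rewrite /v mulrC fmorphV rmorph_nat.
  rewrite /w tu; apply/eqP; rewrite eq_complex /= cosD sinD; apply/andP; split.
    rewrite mul0r subr0 mul0r subr0; apply/eqP.
    by have := cos2Dsin2 u => h; lra.
  by rewrite mul0r addr0 mul0r addr0; apply/eqP; field.
have vX n : v ^+ n = (cos u ^+ n)%:C * expi (n%:R * u).
  by rewrite vE exprMn expiX rmorphXn.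
have -> : delta_TTR J c (- w) = 2 * v + 2 * v ^+ 2 + (2 * c 2%N)%:C * v ^+ 3
    + v ^+ 4 * T.
  have ve : 1 - - w = 2 * v by rewrite opprK /v; field.
  rewrite /delta_TTR ve big_ltn; last by rewrite ltnS.
  rewrite addrA; congr (_ + _).
    by rewrite rmorphM rmorph_nat /=; field.
  rewrite /T big_distrr /= big_seq [RHS]big_seq; apply: eq_bigr => l.
  rewrite mem_index_iota => /andP[l3 _].
  rewrite (_ : l.+1 = 4 + (l - 3))%N; last lia.
  rewrite -{1}(subnKC l3) addnC; move: (l - 3)%N => m.
  by rewrite rmorphM rmorph_nat /= exprMn !exprD; field; rewrite expf_neq0 ?pnatr_eq0.
have QE : (map_poly (real_complex R) (quot_poly J c)).[w] =
    (4 - 2 * c 2%N)%:C + (4 * c 2%N)%:C * w + w ^+ 2 * T.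
  rewrite /quot_poly !rmorphD rmorphM /= !map_polyC /= map_polyZ map_polyX map_polyXn /=.
  rewrite rmorph_sum /= !(hornerE, horner_sum).
  congr (_ + _ * _); apply: eq_bigr => l _.
  rewrite map_polyZ rmorphXn /= map_polyZ rmorphD /= map_polyX rmorph1 !hornerE.
  by congr (_ * _ ^+ _); rewrite fmorphV rmorph_nat /v mulrC addrC.
rewrite /cos_poly QE.
have -> : v ^+ 4 * T = (cos u ^+ 4)%:C * (w ^+ 2 * T).
  by rewrite vX mulrA expiX; congr (_ * expi _ * _); rewrite tu; ring.
rewrite [LHS]ReD ReZ [in RHS]ReD [RHS]mulrDr; congr (_ + _).
rewrite -[X in 2 * X + _]expr1 !vX.
have -> : 2 = (2 : R)%:C by rewrite rmorph_nat.
rewrite !ReD !ReZ mul1r /= tu.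
have -> : 3%:R * u = u + (u + u) by ring.
have -> : 2%:R * u = u + u by ring.
rewrite !(cosD, sinD).
have := sin2cos2 u; move: (sin u) (cos u) => a b; rewrite expr2 => h.
transitivity (2 * b ^+ 2 + 2 * b ^+ 2 * (b * b - a * a)
  + 2 * c 2%N * b ^+ 4 * (b * b - 3 * (a * a))); first by ring.
by rewrite h; ring.
Qed.

Lemma coef_quot_poly J c :
  ((quot_poly J c)`_0 = 4 - 2 * c 2%N) * ((quot_poly J c)`_1 = 4 * c 2%N).
Proof.
rewrite /quot_poly; set S := \sum_(_ <= _ < _) _; split.
  by rewrite !coefD coefC coefZ coefX coefXnM /= mulr0 !addr0.
by rewrite !coefD coefC coefZ coefX coefXnM /= mulr1 addr0 add0r.
Qed.

(** The substitution v = (1 + w) / 2 is an automorphism of the polynomials that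
    preserves the degree, so the sum over l >= 3 reaches every polynomial of
    size at most J - 2.  The relation between the two lowest coefficients is the
    elimination of c_2 from 4 - 2 c_2 and 4 c_2. *)
Lemma quot_poly_onto J p : (2 <= J)%N -> (size p <= J)%N ->
  p`_1 = 2 * (4 - p`_0) -> exists c, quot_poly J c = p.
Proof.
move=> J2 sp p1.
pose B := drop_poly 2 p \Po (2 *: 'X - 1%:P).
exists (fun l => if l == 2%N then p`_1 / 4 else B`_(l - 3) / 2).
rewrite /quot_poly /=.
have -> : 4 - 2 * (p`_1 / 4) = p`_0 by rewrite p1; field.
have -> : 4 * (p`_1 / 4) = p`_1 by field.
rewrite -[RHS](poly_take_drop 2) mulrC; congr (_ + _ * _).
  apply/polyP => i; rewrite coef_take_poly coefD coefC coefZ coefX.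
  by case: i => [|[|i]] //=; rewrite ?mulr1 ?mulr0 ?addr0 ?add0r.
have sB : (size B <= J - 2)%N.
  rewrite size_comp_poly2; last first.
    have -> : 2 *: 'X - 1%:P = 2 *: ('X - (2^-1)%:P) :> {poly R}.
      by rewrite scalerBr -[2 *: (_)%:P]mul_polyC -polyCM mulfV ?pnatr_eq0.
    by rewrite size_scale ?pnatr_eq0 // size_XsubC.
  by rewrite size_drop_poly leq_sub2r.
transitivity (B \Po (2^-1 *: ('X + 1))).
  rewrite comp_polyE -[in LHS](add0n 3%N) big_addn.
  rewrite (_ : (J.+1 - 3)%N = (J - 2)%N); last lia.
  rewrite (big_ord_widen _ (fun i => B`_i *: (2^-1 *: ('X + 1)) ^+ i) sB).
  rewrite big_mkord [RHS]big_mkcond; apply: eq_bigr => i _.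
  rewrite addnK ifF; last lia.
  rewrite mulrC divfK ?pnatr_eq0 //; case: ltnP => // Bi.
  by rewrite nth_default ?scale0r.
rewrite /B -comp_polyA.
rewrite (_ : _ \Po (_ *: _) = 'X) ?comp_polyXr //.
rewrite comp_polyB comp_polyZ comp_polyX comp_polyC scalerA mulfV ?pnatr_eq0 //.
by rewrite scale1r addrK.
Qed.

(** At t = pi the factor cos (t/2)^4 vanishes and A-stability gives no direct
    information, so nonnegativity there follows by continuity. *)
Lemma A_stable_quot_ge0 J c : (2 <= J)%N -> A_stable J c ->
  forall t, 0 <= t <= 2 * pi -> 0 <= cos_poly (quot_poly J c) t.
Proof.
move=> J2 Ac.
have off_pi t : 0 <= t <= 2 * pi -> t != pi -> 0 <= cos_poly (quot_poly J c) t.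
  move=> /andP[t0 t2] tpi.
  have [th th02 thE] : exists2 th, 0 <= th <= 2 * pi & expi th = - expi t.
    have [lt_t|le_t] := ltrP t pi.
      by exists (t + pi); [lra | rewrite expiN].
    by exists (t - pi); [lra | rewrite -[t in RHS](subrK pi) -expiN opprK].
  have := Ac th th02; rewrite thE Re_delta // pmulr_rge0 // exprn_even_gt0 //=.
  have pi0 := @pi_gt0 R.
  have [lt_t|le_t] := ltrP t pi; first by rewrite gt_eqF // cos_gt0_pihalf //; lra.
  have -> : cos (t / 2) = - cos (t / 2 - pi) by rewrite -cosDpi subrK.
  rewrite oppr_eq0.
  by rewrite gt_eqF // cos_gt0_pihalf //; move: tpi; rewrite neq_lt => tpi; lra.
move=> t t02; have [->|] := eqVneq t pi; last exact: off_pi.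
apply: (cvgr_to_ge (F := pi^'+) (f := cos_poly (quot_poly J c))).
  by apply: cvg_at_right_filter; exact: continuous_cos_poly.
near=> y; apply: off_pi; last by rewrite gt_eqF //; near: y; exact: nbhs_right_gt.
have pi_y : pi < y by near: y; exact: nbhs_right_gt.
have pi0 := @pi_gt0 R.
rewrite (le_trans (ltW pi0) (ltW pi_y)) /=.
by near: y; apply: nbhs_right_le; have := @pi_gt0 R; lra.
Unshelve. all: by end_near.
Qed.

Lemma quot_ge0_A_stable J c : (2 <= J)%N ->
  (forall t, 0 <= cos_poly (quot_poly J c) t) -> A_stable J c.
Proof.
move=> J2 q0 th _; rewrite -[expi th]opprK expiN Re_delta //.
by rewrite mulr_ge0 // exprn_even_ge0.
Qed.

(** * The optimal second coefficient *)

Section Optimum.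
Variable J : nat.
Hypothesis J2 : (2 <= J)%N.
Let x : R := pi / J.+1%:R.

Let cos_half_gt0 : 0 < cos (x / 2).
Proof.
have pi0 := @pi_gt0 R; apply: cos_gt0_pihalf; apply/andP; split.
  by rewrite (@lt_trans _ _ 0) // ?oppr_lt0 ?divr_gt0.
by rewrite ltr_pM2r // /x ltr_pdivrMr // ltr_pMr // ltr1n; lia.
Qed.

Let cos_xE : cos x = 2 * cos (x / 2) ^+ 2 - 1.
Proof.
have {1}-> : x = (x / 2) *+ 2 by rewrite -mulr_natr; field.
by rewrite cos_mulr2n -mulr_natl.
Qed.

Lemma one_sub_tan2_half : 1 - tan (x / 2) ^+ 2 = 2 * cos x / (1 + cos x).
Proof.
rewrite /tan cos_xE expr_div_n sin2cos2 [1 + (_ - 1)]addrC subrK.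
by field; rewrite gt_eqF.
Qed.

Lemma A_stable_c2_le c : A_stable J c -> c 2%N <= 1 - tan (x / 2) ^+ 2.
Proof.
move=> Ac; have := fejer_bound (size_quot_poly c J2) (A_stable_quot_ge0 J2 Ac).
rewrite !coef_quot_poly -/x one_sub_tan2_half => h.
have := exprn_gt0 2 cos_half_gt0 => h2.
rewrite ler_pdivlMr; first by lra.
by rewrite cos_xE; lra.
Qed.

Lemma A_stable_c2_attained :
  exists c, A_stable J c /\ c 2%N = 1 - tan (x / 2) ^+ 2.
Proof.
have [|p [sp p_ge0 p0 p1]] := @fejer_sharp R J; first lia.
rewrite -/x in p1.
have x1 : 0 < 1 + cos x by have := exprn_gt0 2 cos_half_gt0; rewrite cos_xE; lra.
(* K makes the constant coefficient equal to 4 - 2 c_2 = 4 / (1 + cos x). *)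
pose K := 4 / ((1 + cos x) * p`_0).
have [||c cE] := @quot_poly_onto J (K *: p) J2.
- exact: leq_trans (size_scale_leq _ _) sp.
- by rewrite !coefZ p1 /K; field; rewrite !gt_eqF.
exists c; split.
  apply: quot_ge0_A_stable => // t; rewrite cE cos_polyZ mulr_ge0 //.
  by rewrite divr_ge0 // mulr_ge0 // ltW.
have := (coef_quot_poly J c).2; rewrite cE coefZ p1 one_sub_tan2_half => h.
apply: (mulfI (_ : 4 != 0)); first by rewrite pnatr_eq0.
by rewrite -h /K; field; rewrite !gt_eqF.
Qed.

End Optimum.
End Reduction.

(** * Limits of real and complex series *)

Section Series.
Variable R : realType.
Implicit Types (t y : R) (e : nat -> R).

(** Convergence at t = 2 bounds the k-th coefficient by M / 2^k, so the terms of
    positive degree contribute at most M y at a point 0 < y <= 1; the constant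
    coefficient is therefore at most M y for all such y.  The point
    t = 0 is left out so that the result applies again after division by t. *)
Lemma pseries_coef0 e :
  (forall t, t != 0 -> pseries e t @ \oo --> (0 : R)) -> e 0%N = 0.
Proof.
move=> e0.
have n2 : 2 != 0 :> R by rewrite pnatr_eq0.
have /cvgP/cvg_series_bounded[K [Kreal Kf]] := e0 2 n2.
pose M : R := `|K| + 1; have M0 : 0 < M by rewrite ltr_wpDl.
have eM k : `|e k| <= M * 2^-1 ^+ k.
  have KM : K < M by rewrite (le_lt_trans (ler_norm K)) // ltrDl.
  have /= := Kf M KM k I.
  by rewrite normrM normrX normr_nat exprVn ler_pdivlMr // exprn_gt0.
have tail n y : 0 < y <= 1 -> `|\sum_(0 <= k < n) e k.+1 * y ^+ k| <= M.
  move=> /andP[y0 y1]; apply: (le_trans (ler_norm_sum _ _ _)).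
  apply: (@le_trans _ _ (series (geometric (M / 2) 2^-1) n)).
    apply: ler_sum => k _; rewrite normrM /= -mulrA -exprS.
    rewrite -[leRHS]mulr1 ler_pM // normrX exprn_ile1 ?normr_ge0 //.
    by rewrite ger0_norm // ltW.
  apply: (le_trans (geometric_le_lim _ _ _ _)); rewrite ?divr_ge0 ?(ltW M0) //.
    by rewrite ger0_norm //; lra.
  by rewrite (_ : 1 - 2^-1 = 2^-1) ?invrK ?divfK //; lra.
have bnd y : 0 < y <= 1 -> `|e 0%N| <= M * y.
  move=> /andP[y0 y1].
  have h1 := e0 y (lt0r_neq0 y0); rewrite -cvg_shiftS in h1.
  have h : (fun n => `|pseries e y n.+1|) @ \oo --> `|0 : R| by exact: cvg_norm.
  rewrite normr0 in h.
  rewrite -subr_le0; apply: (cvgr_to_ge h); near=> n.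
  rewrite /= lerBlDr /pseries /series /= big_nat_recl // expr0 mulr1.
  rewrite (eq_bigr (fun k => y * (e k.+1 * y ^+ k))); last first.
    by move=> k _; rewrite exprS mulrCA.
  rewrite -mulr_sumr; set S := \sum_(_ <= _ < _) _.
  have -> : e 0%N = (e 0%N + y * S) - y * S by rewrite addrK.
  apply: (le_trans (ler_normB _ _)); rewrite addrK lerD2l normrM gtr0_norm //.
  by rewrite mulrC ler_pM2r // tail // y0.
apply/eqP; rewrite -normr_eq0; apply/eqP/le_anti; rewrite normr_ge0 andbT.
apply/ler_addgt0Pl => d d0; rewrite addr0.
have d1 : 0 < Num.min 1 (d / M) by rewrite lt_min ltr01 divr_gt0.
apply: (le_trans (bnd (Num.min 1 (d / M)) _)); first by rewrite d1 ge_min lexx.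
by rewrite mulrC -ler_pdivlMr // ge_min lexx orbT.
Unshelve. all: by end_near.
Qed.

Lemma pseries_eq0 e :
  (forall t, t != 0 -> pseries e t @ \oo --> (0 : R)) -> forall k, e k = 0.
Proof.
move=> h k; elim: k e h => [|k IHk] e h; first exact: pseries_coef0.
apply: (IHk (fun k => e k.+1)) => t t0.
have h1 := h t t0; rewrite -cvg_shiftS in h1.
rewrite (_ : pseries _ _ = (fun n => pseries e t n.+1 * t^-1)); last first.
  apply/funext => n; rewrite /pseries /series /= big_nat_recl // pseries_coef0 //.
  rewrite mul0r add0r mulr_suml; apply: eq_bigr => i _.
  by rewrite exprSr mulrA mulfK.
by rewrite -(mul0r t^-1); apply: cvgM => //; exact: cvg_cst.
Qed.

Lemma normc_real (r : R) : `|r%:C| = `|r|%:C.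
Proof. by rewrite normc_def /= expr0n addr0 sqrtr_sqr. Qed.

Lemma normi : `|'i%C : R[i]| = 1.
Proof. by rewrite normc_def /= expr0n add0r expr1n sqrtr1. Qed.

Lemma normc_ge_Im (z : R[i]) : `|complex.Im z|%:C <= `|z|.
Proof.
rewrite -[leRHS]mulr1 -normi -normrM -normrN -ReiNIm; exact: normc_ge_Re.
Qed.

Lemma cvg_Im (u : nat -> R[i]) (l : R[i]) :
  (u : nat -> R[i]^o) @ \oo --> (l : R[i]^o) ->
  (fun n => complex.Im (u n)) @ \oo --> complex.Im l.
Proof.
move=> /cvgrPdist_lt h; apply/cvgrPdist_lt => d d0.
have := h d%:C; rewrite ltcR => /(_ d0); apply: filterS => n.
rewrite -ltcR; apply: le_lt_trans.
have -> : complex.Im l - complex.Im (u n) = complex.Im (l - u n).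
  by case: {h} l (u n) => [? ?] [].
exact: normc_ge_Im.
Qed.

Lemma cvg_complex (a b : nat -> R) (x y : R) :
  a @ \oo --> x -> b @ \oo --> y ->
  (fun n => a n +i* b n : R[i]^o) @ \oo --> (x +i* y : R[i]^o).
Proof.
move=> /cvgrPdist_lt ha /cvgrPdist_lt hb; apply/cvgrPdist_lt => d.
case: d => d d'; rewrite ltcE /= => /andP[/eqP -> d0].
have d2 : 0 < d / 2 by rewrite divr_gt0.
near=> n.
have -> : (x +i* y) - (a n +i* b n) = (x - a n)%:C + 'i%C * (y - b n)%:C.
  by rewrite [LHS]complexE.
apply: (le_lt_trans (ler_normD _ _)).
rewrite normrM normi mul1r !normc_real complexr0.
rewrite -rmorphD /= ltcR (splitr d) ltrD //.
  by near: n; exact: ha.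
by near: n; exact: hb.
Unshelve. all: by end_near.
Qed.

Lemma expr_i k : 'i%C ^+ k =
  ((~~ odd k)%:R * (-1) ^+ k./2) +i* ((odd k)%:R * (-1) ^+ k.-1./2) :> R[i].
Proof.
elim: k => [|k IHk]; first by rewrite expr0 mul1r mul0r.
rewrite exprS IHk /=; apply/eqP; rewrite eq_complex /= !mul0r !mul1r !add0r.
rewrite negbK; apply/andP; split=> //.
case: (boolP (odd k)) => [ok|_]; last by rewrite !mul0r oppr0.
by case: k ok {IHk} => [//|k] /= _; rewrite exprS mulN1r mulrN.
Qed.

(** Separating the even and odd powers of i turns the exponential series into
    the cosine and sine series. *)
Lemma cvg_expi t :
  (fun n => \sum_(0 <= k < n) 'i%C ^+ k * (t ^+ k / k`!%:R)%:C : R[i]^o) @ \oo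
    --> (expi t : R[i]^o).
Proof.
rewrite (_ : (fun _ => _) =
    (fun n => series (cos_coeff t) n +i* series (sin_coeff t) n : R[i]^o)); last first.
  apply/funext => n; elim: n => [|n IHn]; rewrite /series /=.
    by rewrite !big_geq.
  rewrite !big_nat_recr //= IHn /series /=; apply/eqP; rewrite eq_complex /=.
  rewrite expr_i /= !mulr0 subr0 add0r /cos_coeff /sin_coeff /= !mulrA.
  by rewrite !eqxx.
by apply: cvg_complex; [rewrite cos.unlock; exact: is_cvg_series_cos_coeff
  | rewrite sin.unlock; exact: is_cvg_series_sin_coeff].
Qed.

End Series.

(** * The expansion in powers of theta *)

Section Expansion.
Variable R : realType.
Implicit Types (p : {poly R}) (t : R) (c C : nat -> R).

(** This is the value at 1 of (X d/dX)^k p. *)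
Definition moment p k : R := \sum_(m < size p) p`_m * m%:R ^+ k.

Lemma moment0 p : moment p 0 = p.[1].
Proof.
by rewrite horner_coef; apply: eq_bigr => m _; rewrite expr0 expr1n.
Qed.

(** m^3 = m + 3 m (m - 1) + m (m - 1) (m - 2). *)
Lemma moment3 p :
  moment p 3 = p^`().[1] + 3 * p^`()^`().[1] + p^`()^`()^`().[1].
Proof.
pose F p : R := p^`().[1] + 3 * p^`()^`().[1] + p^`()^`()^`().[1].
have FD q r : F (q + r) = F q + F r by rewrite /F !derivD !hornerD; ring.
have F0 : F 0 = 0 by rewrite /F !deriv0 !horner0; ring.
rewrite -/(F p) -[in RHS](coefK p) poly_def (big_morph F FD F0).
apply: eq_bigr => m _; rewrite /F !derivZ !derivXn.
rewrite !(derivMn, derivXn) !hornerZ !hornerMn !hornerXn !expr1n.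
by case: (m : nat) => [|[|[|k]]] /=; ring.
Qed.

(** Each e^(i m t) is expanded separately; the finite sum over m is then moved
    inside the sum over k, where it produces the moments. *)
Lemma cvg_theta p t :
  (fun n => \sum_(0 <= k < n) 'i%C ^+ k * (moment p k / k`!%:R)%:C * t%:C ^+ k
     : R[i]^o) @ \oo --> ((map_poly (real_complex R) p).[expi t] : R[i]^o).
Proof.
rewrite (@horner_coef_wide _ (size p)) ?size_map_poly //.
rewrite (_ : (fun _ => _) = (fun n => \sum_(m < size p) (p`_m)%:C *
   \sum_(0 <= k < n) 'i%C ^+ k * ((m%:R * t) ^+ k / k`!%:R)%:C : R[i]^o)).
  elim: (size p) => [|s IHs].
    rewrite (_ : (fun _ => _) = cst 0) ?big_ord0; first exact: cvg_cst.
    by apply/funext => n; rewrite big_ord0.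
  rewrite (_ : (fun _ => _) = (fun n => \sum_(m < s) (p`_m)%:C *
   (\sum_(0 <= k < n) 'i%C ^+ k * ((m%:R * t) ^+ k / k`!%:R)%:C) +
   (p`_s)%:C * (\sum_(0 <= k < n) 'i%C ^+ k * ((s%:R * t) ^+ k / k`!%:R)%:C) : R[i]^o)).
    rewrite big_ord_recr /=; apply: cvgD; first exact: IHs.
    rewrite coef_map expiX; apply: cvgM; first exact: cvg_cst.
    exact: cvg_expi.
  by apply/funext => n; rewrite big_ord_recr.
apply/funext => n; rewrite (eq_bigr _ (fun _ _ => mulr_sumr _ _ _ _)) exchange_big /=.
apply: eq_bigr => k _; rewrite !rmorphM rmorph_sum /= mulr_suml mulr_sumr mulr_suml.
by apply: eq_bigr => m _; rewrite !(rmorphM, rmorphXn) /= exprMn; ring.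
Qed.

Definition delta_poly J c : {poly R} :=
  (1 - 'X) + 2^-1 *: (1 - 'X) ^+ 2
  + \sum_(2 <= l < J.+1) (2 ^- l * c l) *: (1 - 'X) ^+ l.+1.

Lemma delta_polyE J c z :
  delta_TTR J c z = (map_poly (real_complex R) (delta_poly J c)).[z].
Proof.
have YE : map_poly (real_complex R) (1 - 'X) = 1 - 'X.
  by rewrite rmorphB rmorph1 /= map_polyX.
have Yz : (1 - 'X : {poly R[i]}).[z] = 1 - z by rewrite !hornerE.
rewrite /delta_poly 2!rmorphD /= map_polyZ rmorphXn /= YE.
rewrite rmorph_sum /= 2!hornerD horner_sum hornerZ horner_exp Yz /delta_TTR.
rewrite fmorphV rmorph_nat /=; congr (_ + _); apply: eq_bigr => l _.
rewrite map_polyZ rmorphXn /= YE hornerZ horner_exp Yz.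
by rewrite rmorphM fmorphV rmorphXn rmorph_nat.
Qed.

(** Factoring out 1 - X repeatedly isolates the terms with l >= 3 in a multiple
    of (1 - X)^4, which does not contribute to the derivatives up to order 3
    at 1. *)
Lemma moment_delta J c : (2 <= J)%N ->
  moment (delta_poly J c) 0 = 0 /\
  moment (delta_poly J c) 3 = 2 - 3 / 2 * c 2%N.
Proof.
move=> J2.
pose G : {poly R} := \sum_(3 <= l < J.+1) (2 ^- l * c l) *: (1 - 'X) ^+ (l - 3).
have -> : delta_poly J c = (1 - 'X) * (1 + (1 - 'X) * ((2^-1)%:P
    + (1 - 'X) * ((c 2%N / 4)%:P + (1 - 'X) * G))).
  rewrite /delta_poly big_ltn; last by rewrite ltnS.
  have -> : \sum_(3 <= l < J.+1) (2 ^- l * c l) *: (1 - 'X) ^+ l.+1 = (1 - 'X) ^+ 4 * G.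
    rewrite /G mulr_sumr big_nat [RHS]big_nat; apply: eq_bigr => l /andP[l3 _].
    by rewrite -scalerAr -exprD (_ : 4 + (l - 3) = l.+1)%N //; lia.
  rewrite -!mul_polyC (_ : 2 ^- 2 * c 2%N = c 2%N / 4); first by ring.
  by field.
rewrite moment0 moment3; set a := c 2%N / 4.
have -> : 3 / 2 * c 2%N = 6 * a by rewrite /a; field.
have Y1 : (1 - 'X : {poly R}).[1] = 0 by rewrite !hornerE subrr.
have dY (H : {poly R}) : ((1 - 'X) * H)^`() = (1 - 'X) * H^`() - H.
  by rewrite derivM derivB derivX derivC sub0r mulN1r addrC.
rewrite hornerM Y1 mul0r; split=> //.
move: (c 2%N) a G => d a G.
rewrite !(dY, derivD, derivN, derivC) !(hornerD, hornerN, hornerM, hornerC, hornerX).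
by field.
Qed.

Lemma theta_expansion_moment J c : (2 <= J)%N ->
  theta_expansion J c (fun k => moment (delta_poly J c) k / k`!%:R).
Proof.
move=> J2 t; rewrite delta_polyE.
rewrite (_ : (fun _ => _) = (fun n => \sum_(0 <= k < n)
   'i%C ^+ k * (moment (delta_poly J c) k / k`!%:R)%:C * t%:C ^+ k : R[i]^o)).
  exact: cvg_theta.
apply/funext => -[|n]; first by rewrite !big_geq.
by rewrite [RHS]big_ltn // (moment_delta c J2).1 mul0r mulr0 mul0r add0r.
Qed.

(** The imaginary part of the expansion is a real power series that involves
    exactly the coefficients of odd index. *)
Lemma theta_expansion_inj_odd J c C C' k : odd k ->
  theta_expansion J c C -> theta_expansion J c C' -> C k = C' k.
Proof.
move=> ok hC hC'.
pose e j : R := complex.Im ('i%C ^+ j) * (C j - C' j).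
suff /eqP : e k = 0.
  by rewrite mulf_eq0 subr_eq0 expr_i /= ok mul1r signr_eq0 => /eqP.
apply: pseries_eq0 => t _.
have ImE A n : complex.Im (\sum_(1 <= j < n) 'i%C ^+ j * (A j)%:C * t%:C ^+ j : R[i])
    = \sum_(0 <= j < n) complex.Im ('i%C ^+ j : R[i]) * A j * t ^+ j.
  case: n => [|n]; first by rewrite !big_geq.
  rewrite [RHS]big_ltn // expr0 /= !mul0r add0r.
  rewrite (big_morph (fun z : R[i] => complex.Im z) (id1 := 0) (op1 := +%R)) //;
    last by move=> [? ?] [].
  apply: eq_bigr => j _; rewrite -mulrA -rmorphXn -rmorphM /=.
  by case: ('i%C ^+ j : R[i]) => u v /=; rewrite mulr0 add0r mulrA.
have h := cvgB (cvg_Im (hC t)) (cvg_Im (hC' t)); rewrite subrr in h.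
suff -> : pseries e t = (fun n =>
    complex.Im (\sum_(1 <= j < n) 'i%C ^+ j * (C j)%:C * t%:C ^+ j : R[i]) -
    complex.Im (\sum_(1 <= j < n) 'i%C ^+ j * (C' j)%:C * t%:C ^+ j : R[i])).
  exact: h.
apply/funext => n; rewrite !ImE -sumrB /pseries /series /=.
by apply: eq_bigr => j _; rewrite /e; ring.
Qed.

End Expansion.

Theorem corollary3p3 (R : realType) (J : nat) (hJ : (2 <= J)%N) :
  let xJ : R := pi / J.+1%:R in
  (exists c : nat -> R, optimal J c) /\
  (forall c : nat -> R, optimal J c ->
     c 2%N = 1 - tan (xJ / 2) ^+ 2 /\
     (exists C : nat -> R, theta_expansion J c C) /\
     (forall C : nat -> R, theta_expansion J c C ->
        `|C 3%N| = 1 / 12 + 1 / 4 * tan (xJ / 2) ^+ 2)).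
Proof.
move=> xJ; have [c0 [Ac0 c0E]] := A_stable_c2_attained R hJ.
split.
  by exists c0; split=> // c' /(A_stable_c2_le hJ); rewrite c0E.
move=> c [Ac cmax].
have cE : c 2%N = 1 - tan (xJ / 2) ^+ 2.
  apply/le_anti; rewrite (A_stable_c2_le hJ Ac) /= -c0E; exact: cmax.
split=> //; split.
  by eexists; exact: theta_expansion_moment.
move=> C hC.
rewrite (theta_expansion_inj_odd (isT : odd 3) hC (@theta_expansion_moment _ _ c hJ)).
rewrite (moment_delta c hJ).2 cE ger0_norm.
  by rewrite (_ : 3`! = 6)%N //; field.
rewrite (_ : 3`! = 6)%N // divr_ge0 //.
by have := sqr_ge0 (tan (xJ / 2)) => h; lra.
Qed.
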